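(* Suppose the standing assumptions (A1)–(A2) and the assumptions (B1)–(B3) of the context hold. Let $R_0\in\mathcal{M}$ be arbitrary, let $\nu_{\max}=\frac{\gamma_2(\bar L_\Psi+\kappa_H)}{1-\eta_2}$ and $N=\theta+\nu_{\max}+\alpha L_\Psi+\alpha\kappa_\Psi M+\kappa_H$. Then, for any $\epsilon>0$, the Riemannian semismooth Newton method described in the context produces a point $R_l\in\mathcal{M}$ such that $\|\operatorname{grad}\Psi(R_l)\|_F\le\epsilon$ in at most $$\left(1+\frac{|\log(\gamma_0)|}{\log(\gamma_1)}\right)\frac{2(\Psi(R_0)-\Psi_{\mathrm{low}})}{\eta_1\nu_{\min}}N^2\frac{1}{\epsilon^2}+\frac{1}{\log(\gamma_1)}\log\left(\frac{\nu_{\max}}{\nu_0}\right)+1$$ iterations.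
   Context: $\mathbb{S}^n$ is the space of real symmetric $n\times n$ matrices, $\langle A,B\rangle=\operatorname{tr}(A^TB)$, $\|\cdot\|_F$ is the Frobenius norm. Given are $A_1,\dots,A_m,B_1,\dots,B_{m_0}\in\mathbb{S}^n$, $b\in\mathbb{R}^m$, $b_0\in\mathbb{R}^{m_0}$; $\mathcal{A}(X)=(\operatorname{tr}(A_iX))_{i=1}^m$, $\mathcal{B}(X)=(\operatorname{tr}(B_iX))_{i=1}^{m_0}$, with adjoints $\mathcal{A}^*,\mathcal{B}^*$. Set $\mathcal{D}=\{X\in\mathbb{S}^n: X\succeq 0,\ \mathcal{B}(X)=b_0\}$ and, for a fixed positive integer $p$, $\mathcal{M}=\{R\in\mathbb{R}^{p\times n}:\mathcal{B}(R^TR)=b_0\}$. The underlying problem is $\min_{X\in\mathcal{D}} f(X)+h(X)$ subject to $\mathcal{A}(X)=b$. Standing assumptions. (A1) This problem has a low-rank optimal solution (no specific rank bound is prescribed) and its objective is bounded from below; $f:\mathbb{S}^n\to\mathbb{R}$ is convex and twice differentiable with Lipschitz continuous gradient; $h:\mathbb{S}^n\to\mathbb{R}\cup\{+\infty\}$ is convex, lower semicontinuous and proper. (A2) For every $X\in\mathcal{D}$ the matrices $B_1X,\dots,B_{m_0}X$ are linearly independent, and $\mathcal{M}$ is a compact embedded submanifold of $\mathbb{R}^{p\times n}$. Subproblem. Fix $y^k\in\mathbb{R}^m$, $Z^k\in\mathbb{S}^n$, $\sigma_k>0$. Let $h^*$ be the convex conjugate of $h$, $\operatorname{prox}_g(W)=\operatorname{argmin}_{V\in\mathbb{S}^n}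 g(V)+\frac12\|V-W\|_F^2$, $T(X)=\sigma_k^{-1}\operatorname{prox}_{\sigma_kh^*}(\sigma_kX-Z^k)$, and $$\Phi(X)=f(X)+h\big(X-Z^k/\sigma_k-T(X)\big)+\tfrac{\sigma_k}{2}\big(\|\mathcal{A}(X)-b-y^k/\sigma_k\|_2^2+\|T(X)\|_F^2\big),\qquad \Psi(R)=\Phi(R^TR).$$ $\Phi$ is continuously differentiable. $\Psi_{\mathrm{low}}$ is a finite lower bound of $\Psi$ on $\mathcal{M}$. Riemannian objects. $T_R\mathcal{M}=\{U\in\mathbb{R}^{p\times n}:\mathcal{B}(R^TU+U^TR)=0\}$, $P_{T_R\mathcal{M}}$ is the orthogonal projection onto it, $P^\perp_{T_R\mathcal{M}}=I-P_{T_R\mathcal{M}}$, and $\operatorname{grad}\Psi(R)=P_{T_R\mathcal{M}}(\nabla\Psi(R))$. $\partial T(X)$ is the Clarke differential of $T$ (convex hull of limits of derivatives at differentiability points). The generalized Riemannian Hessian $\operatorname{Hess}\Psi(R)$ is the set of operators $U\mapsto P_{T_R\mathcal{M}}(G[U])+\mathfrak{W}_R(U,P^\perp_{T_R\mathcal{M}}(\nabla\Psi(R)))$ on $T_R\mathcal{M}$, where $G[U]=2U\nabla\Phi(R^TR)+2R\,\mathcal{V}[R^TU+U^TR]$, $\mathcal{V}=\nabla^2f(R^TR)+\sigma_k\mathcal{A}^*\mathcal{A}+\sigma_k\Theta$ with $\Theta\in\partial T(R^TR)$, and $\mathfrak{W}_R(U,V)=-P_{T_R\mathcal{M}}D_UV$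 for $V$ normal at $R$ ($D_UV$ the derivative at $R$ along $U$ of any extension of $V$ to a normal vector field on $\mathcal{M}$). $\mathcal{R}$ is a retraction on $\mathcal{M}$. Assumptions. (B1) There are $\kappa_\Psi,\kappa_H$ with $\|\nabla\Psi(R)\|_F\le\kappa_\Psi$ and $\|\operatorname{Hess}\Psi(R)[U]\|_F\le\kappa_H\|U\|_F$ (for every element of the generalized Hessian) for all $R\in\mathcal{M}$, $U\in T_R\mathcal{M}$. (B2) There are $\alpha,\beta>0$ with $\|\mathcal{R}_R(U)-R\|_F\le\alpha\|U\|_F$ and $\|\mathcal{R}_R(U)-R-U\|_F\le\beta\|U\|_F^2$ for all $R\in\mathcal{M}$, $U\in T_R\mathcal{M}$. (B3) There is a finite $M>0$ with $\|P_{T_R\mathcal{M}}(V)-P_{T_W\mathcal{M}}(V)\|_F\le M\|V\|_F\|U\|_F$ for all $R\in\mathcal{M}$, $U\in T_R\mathcal{M}$, $V\in\mathbb{R}^{p\times n}$, where $W=\mathcal{R}_R(U)$. Constants. $L_\Psi$ is a Lipschitz constant of $\nabla\Psi$ on $\mathcal{M}$. $\bar L_\Psi$ is a constant such that $\Psi(\mathcal{R}_R(U))\le\Psi(R)+\langle\operatorname{grad}\Psi(R),U\rangle+\frac{\bar L_\Psi}{2}\|U\|_F^2$ for all $R\in\mathcal{M}$, $U\in T_R\mathcal{M}$ (such constants exist). Algorithm. Parameters: $0<\eta_1\le\eta_2<1$, $0<\gamma_0<1<\gamma_1\le\gamma_2$, $\nu_{\min}>0$, $\theta\ge0$, $\mu>0$,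 and an initial regularization parameter $\nu_0>0$. At iteration $l$, with $\mathfrak{H}_l\in\operatorname{Hess}\Psi(R_l)$ and $$m_l(U)=\langle\operatorname{grad}\Psi(R_l),U\rangle+\tfrac12\langle\mathfrak{H}_l[U],U\rangle+\tfrac{\nu_l}{2}\|U\|_F^2,\quad U\in T_{R_l}\mathcal{M},$$ a step $U_l\in T_{R_l}\mathcal{M}$ (the line-search step size is absorbed into $U_l$) is computed satisfying $\|\nabla m_l(U_l)\|_F\le\theta\|U_l\|_F$, $m_l(U_l)\le0$, $\langle U_l,\operatorname{grad}\Psi(R_l)\rangle<0$ and the Armijo condition $m_l(U_l)\le\mu\langle\operatorname{grad}\Psi(R_l),U_l\rangle$. Put $\bar R_l=\mathcal{R}_{R_l}(U_l)$ and $\rho_l=\frac{\Psi(\bar R_l)-\Psi(R_l)}{m_l(U_l)-\frac{\nu_l}{2}\|U_l\|_F^2}$. If $\rho_l\ge\eta_1$ the iteration is successful and $R_{l+1}=\bar R_l$; otherwise $R_{l+1}=R_l$. Then $\nu_{l+1}\in[\max(\nu_{\min},\gamma_0\nu_l),\nu_l]$ if $\rho_l\ge\eta_2$; $\nu_{l+1}\in[\nu_l,\gamma_1\nu_l]$ if $\eta_1\le\rho_l<\eta_2$; $\nu_{l+1}\in[\gamma_1\nu_l,\gamma_2\nu_l]$ otherwise. The algorithm is run without an iteration limit.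
   Formalization: The formal theorem additionally assumes ν_min ≤ ν_0 ≤ ν_max: for very large ν_0 the stated bound is negative and so fails, and for ν_0 < ν_min the update interval [max(ν_min, γ_0ν_l), ν_l] is empty. *)

(* Defs.v *)
From HB Require Import structures.
From mathcomp Require Import all_boot all_order all_algebra.
From mathcomp Require Import all_classical all_reals all_analysis.
From mathcomp Require Import ring lra.

Set Implicit Arguments.
Unset Strict Implicit.
Unset Printing Implicit Defensive.

Import Order.TTheory GRing.Theory Num.Theory.
Import numFieldNormedType.Exports.

Local Open Scope classical_set_scope.
Local Open Scope ring_scope.

(* The library norm on 'M[R]_(p, n) is the max norm.  The Frobenius norm is
   therefore introduced separately; the topology, and hence continuity,
   compactness and Frechet differentiability, are the same for both norms. *)

Section Frobenius.
Context {R : realType} {p n : nat}.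
Implicit Types A B C : 'M[R]_(p, n).

Definition ip A B : R := \tr (A^T *m B).

Definition frob A : R := Num.sqrt (ip A A).

Lemma ipE A B : ip A B = \sum_j \sum_i A i j * B i j.
Proof.
rewrite /ip /mxtrace; apply: eq_bigr => j _; rewrite mxE.
by apply: eq_bigr => i _; rewrite mxE.
Qed.

Lemma ipC A B : ip A B = ip B A.
Proof.
rewrite !ipE; apply: eq_bigr => j _; apply: eq_bigr => i _; exact: mulrC.
Qed.

Lemma ipDl A B C : ip (A + B) C = ip A C + ip B C.
Proof. by rewrite /ip linearD/= mulmxDl linearD. Qed.

Lemma ipZl (a : R) A B : ip (a *: A) B = a * ip A B.
Proof. by rewrite /ip linearZ/= -scalemxAl linearZ. Qed.

Lemma ipDr A B C : ip A (B + C) = ip A B + ip A C.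
Proof. by rewrite ipC ipDl !(ipC A). Qed.

Lemma ipZr (a : R) A B : ip A (a *: B) = a * ip A B.
Proof. by rewrite ipC ipZl (ipC A). Qed.

Lemma ip_ge0 A : 0 <= ip A A.
Proof.
by rewrite ipE; apply: sumr_ge0 => j _; apply: sumr_ge0 => i _; rewrite -expr2 sqr_ge0.
Qed.

Lemma ip_eq0 A : ip A A = 0 -> A = 0.
Proof.
move=> /eqP; rewrite ipE psumr_eq0; last first.
  by move=> j _; apply: sumr_ge0 => i _; rewrite -expr2 sqr_ge0.
move=> /allP A0; apply/matrixP => i j; rewrite mxE.
have := A0 j (mem_index_enum j); rewrite psumr_eq0; last first.
  by move=> k _; rewrite -expr2 sqr_ge0.
by move=> /allP/(_ i (mem_index_enum i)); rewrite -expr2 sqrf_eq0 => /eqP.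
Qed.

Lemma frob_ge0 A : 0 <= frob A. Proof. exact: sqrtr_ge0. Qed.

Lemma frob_sqr A : frob A ^+ 2 = ip A A.
Proof. by rewrite sqr_sqrtr ?ip_ge0. Qed.

Lemma frob_eq0 A : frob A = 0 -> A = 0.
Proof.
by move=> A0; apply: ip_eq0; rewrite -frob_sqr A0 expr0n.
Qed.

Lemma frobZ (a : R) A : frob (a *: A) = `|a| * frob A.
Proof.
by rewrite /frob ipZl ipZr mulrA -expr2 sqrtrM ?sqr_ge0// sqrtr_sqr.
Qed.

Lemma ip_le_frob A B : ip A B <= frob A * frob B.
Proof.
have [B0|B0] := eqVneq (frob B) 0.
  by rewrite (frob_eq0 B0) /ip mulmx0 mxtrace0 mulr_ge0 ?frob_ge0.
have b_gt0 : 0 < frob B by rewrite lt_neqAle eq_sym B0 frob_ge0.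
have := ip_ge0 (frob B ^+ 2 *: A + (- ip A B) *: B).
rewrite ipDl !ipDr !ipZl !ipZr (ipC B A) -!frob_sqr => H.
have {}H : 0 <= frob B ^+ 2 * ((frob A * frob B) ^+ 2 - ip A B ^+ 2) by lra.
move: H; rewrite pmulr_rge0 ?exprn_gt0// subr_ge0 => H.
apply: le_trans (ler_norm _) _.
by rewrite -(@ler_pXn2r _ 2)// ?nnegrE ?mulr_ge0 ?frob_ge0// -normrX ger0_norm ?sqr_ge0.
Qed.

Lemma frobD A B : frob (A + B) <= frob A + frob B.
Proof.
rewrite -(@ler_pXn2r _ 2)// ?nnegrE ?addr_ge0 ?frob_ge0//.
rewrite frob_sqr ipDl !ipDr (ipC B A) sqrrD !frob_sqr.
by have := ip_le_frob A B; lra.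
Qed.

End Frobenius.

(* The Euclidean space S^n, with the Frobenius norm as its norm. *)

Definition symmetric_pred {R : realType} {n : nat} : {pred 'M[R]_n} :=
  fun X => X^T == X.

Section SymmetricSubmod.
Context {R : realType} {n : nat}.

Fact symmetric_submod_closed : submod_closed (@symmetric_pred R n).
Proof.
split; first by rewrite unfold_in trmx0.
move=> a X Y /eqP XT /eqP YT.
by rewrite unfold_in linearD linearZ /= XT YT.
Qed.

HB.instance Definition _ :=
  GRing.isSubmodClosed.Build R 'M[R]_n symmetric_pred symmetric_submod_closed.

End SymmetricSubmod.

Record symmat (R : realType) (n : nat) :=
  SymMat { symval :> 'M[R]_n ; symvalP : symmetric_pred symval }.

Section SymmetricSpace.
Context {R : realType} {n : nat}.

HB.instance Definition _ := [isSub for @symval R n].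
HB.instance Definition _ := [Choice of symmat R n by <:].
HB.instance Definition _ := [SubChoice_isSubLmodule of symmat R n by <:].

Fact symfrobD (X Y : symmat R n) :
  frob (symval (X + Y)) <= frob (symval X) + frob (symval Y).
Proof. exact: frobD. Qed.

Fact symfrobZ (a : R) (X : symmat R n) :
  frob (symval (a *: X)) = `|a| * frob (symval X).
Proof. exact: frobZ. Qed.

Fact symfrob_eq0 (X : symmat R n) : frob (symval X) = 0 -> X = 0.
Proof. by move=> /frob_eq0 X0; apply: val_inj. Qed.

HB.instance Definition _ :=
  Lmodule_isNormed.Build R (symmat R n) symfrobD symfrobZ symfrob_eq0.

Definition sip (X Y : symmat R n) : R := ip (symval X) (symval Y).

Fact gram_subproof {p : nat} (Q : 'M[R]_(p, n)) : symmetric_pred (Q^T *m Q).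
Proof. by rewrite /symmetric_pred trmx_mul trmxK. Qed.

Definition gram {p : nat} (Q : 'M[R]_(p, n)) : symmat R n :=
  SymMat (gram_subproof Q).

Fact dgram_subproof {p : nat} (Q U : 'M[R]_(p, n)) :
  symmetric_pred (Q^T *m U + U^T *m Q).
Proof.
by rewrite /symmetric_pred linearD /= !trmx_mul !trmxK addrC.
Qed.

Definition dgram {p : nat} (Q U : 'M[R]_(p, n)) : symmat R n :=
  SymMat (dgram_subproof Q U).

Definition psd (X : symmat R n) : Prop :=
  forall x : 'cV[R]_n, 0 <= \tr (x^T *m symval X *m x).

End SymmetricSpace.

Section Calculus.
Context {R : realType}.

Definition is_grad (E : normedModType R) (dot : E -> E -> R) (F : E -> R)
    (x : E) (g : E) : Prop :=
  differentiable (F : E -> R^o) x /\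
  forall v, ('d (F : E -> R^o) x : E -> R^o) v = dot g v.

Definition grad_of (E : normedModType R) (dot : E -> E -> R) (F : E -> R)
    (x : E) : E := xget 0 [set g | is_grad dot F x g].

Fixpoint Cn (E E' : normedModType R) (k : nat) (O : set E) (F : E -> E') : Prop :=
  if k is k'.+1 then
    (forall x, O x -> differentiable F x) /\
    (forall v, Cn k' O (fun x => 'd F x v))
  else forall x, O x -> {for x, continuous F}.

Definition smooth_on (E E' : normedModType R) (O : set E) (F : E -> E') : Prop :=
  open O /\ forall k, Cn k O F.

(* Embedded submanifold: locally the zero set of k smooth functions with
   linearly independent differentials. *)
Definition embedded_submanifold (E : normedModType R) (S : set E) : Prop :=
  exists k : nat, forall x, S x -> exists (O : set E) (F : 'I_k -> E -> R),
    [/\ O x,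
        forall i, smooth_on O (F i : E -> R^o),
        forall z, O z -> (S z <-> forall i, F i z = 0) &
        forall c : 'I_k -> R,
          (forall v, \sum_i c i * ('d (F i : E -> R^o) x : E -> R^o) v = 0) ->
          forall i, c i = 0].

(* Clarke differential.  In finite dimension, pointwise convergence of linear
   maps is convergence in operator norm. *)
Definition limiting_jacobian (E E' : normedModType R) (F : E -> E') (x : E) :
    set (E -> E') :=
  [set J | exists xs : nat -> E,
     [/\ xs @ \oo --> x,
         forall k, differentiable F (xs k) &
         forall v, (fun k => 'd F (xs k) v) @ \oo --> J v]].

Definition clarke (E E' : normedModType R) (F : E -> E') (x : E) :
    set (E -> E') :=
  [set J | exists (k : nat) (w : 'I_k -> R) (Js : 'I_k -> E -> E'),
     [/\ forall i, 0 <= w i, \sum_i w i = 1,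
         forall i, limiting_jacobian F x (Js i) &
         forall v, J v = \sum_i w i *: Js i v]].

Definition econvex (E : normedModType R) (h : E -> \bar R) : Prop :=
  forall (X Y : E) (t : R), 0 <= t <= 1 ->
    (h (t *: X + (1 - t) *: Y)%R <= t%:E * h X + (1 - t)%:E * h Y)%E.

Definition proper (E : normedModType R) (h : E -> \bar R) : Prop :=
  (forall X, (-oo < h X)%E) /\ exists X, (h X < +oo)%E.

Definition conjugate (E : normedModType R) (dot : E -> E -> R)
    (h : E -> \bar R) (Y : E) : \bar R :=
  ereal_sup [set ((dot Y X)%:E - h X)%E | X in [set: E]].

Definition is_prox (E : normedModType R) (g : E -> \bar R) (W V : E) : Prop :=
  forall V', (g V + (2^-1 * `|V - W| ^+ 2)%:E <=
              g V' + (2^-1 * `|V' - W| ^+ 2)%:E)%E.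

Definition prox (E : normedModType R) (g : E -> \bar R) (W : E) : E :=
  xget 0 [set V | is_prox g W V].

End Calculus.

Record problem (R : realType) (n m m0 : nat) := Problem {
  fobj : symmat R n -> R;
  hobj : symmat R n -> \bar R;
  matA : 'I_m -> symmat R n;
  matB : 'I_m0 -> symmat R n;
  rhsA : 'cV[R]_m;
  rhsB : 'cV[R]_m0 }.

Record subproblem (R : realType) (n m : nat) := Subproblem {
  ysub : 'cV[R]_m;
  Zsub : symmat R n;
  sigma : R }.

Section Problem.
Context {R : realType} {n m m0 : nat} (D : problem R n m m0).

Definition trace_map {k : nat} (C : 'I_k -> symmat R n) (X : symmat R n) :
    'cV[R]_k := \col_i \tr (symval (C i) *m symval X).

Definition opA : symmat R n -> 'cV[R]_m := trace_map (matA D).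
Definition opB : symmat R n -> 'cV[R]_m0 := trace_map (matB D).

Definition adjA (z : 'cV[R]_m) : symmat R n := \sum_i z i 0 *: matA D i.

Definition domD : set (symmat R n) := [set X | psd X /\ opB X = rhsB D].

Definition feasible : set (symmat R n) := [set X | domD X /\ opA X = rhsA D].

Definition objective (X : symmat R n) : \bar R := ((fobj D X)%:E + hobj D X)%E.

Definition optimal_solution (X : symmat R n) : Prop :=
  [/\ feasible X, (objective X < +oo)%E &
      forall Y, feasible Y -> (objective X <= objective Y)%E].

Definition gradf : symmat R n -> symmat R n := grad_of sip (fobj D).

(* No rank bound being prescribed, "low-rank" does not restrict the optimal
   solution. *)
Record objective_assumptions : Prop := ObjectiveAssumptions {
  has_optimal_solution : exists X, optimal_solution X;
  objective_bounded_below :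
    exists c : R, forall X, feasible X -> (c%:E <= objective X)%E;
  fobj_convex : convex_function setT (fobj D : _ -> R^o);
  fobj_differentiable : forall X, differentiable (fobj D : _ -> R^o) X;
  fobj_twice_differentiable : forall X, differentiable gradf X;
  fobj_grad_lipschitz :
    exists L : R, forall X Y, `|gradf X - gradf Y| <= L * `|X - Y|;
  hobj_convex : econvex (hobj D);
  hobj_lsc : lower_semicontinuous (hobj D);
  hobj_proper : proper (hobj D) }.

Context {p : nat}.

Definition manM : set 'M[R]_(p, n) := [set Q | opB (gram Q) = rhsB D].

Record constraint_assumptions : Prop := ConstraintAssumptions {
  constraint_free : forall X, domD X ->
    free [seq symval (matB D i) *m symval X | i : 'I_m0];
  manM_compact : compact manM;
  manM_submanifold : embedded_submanifold manM }.

Definition tangent (Q : 'M[R]_(p, n)) : set 'M[R]_(p, n) :=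
  [set U | opB (dgram Q U) = 0].

Definition is_proj (Q V W : 'M[R]_(p, n)) : Prop :=
  tangent Q W /\ forall U, tangent Q U -> ip (V - W) U = 0.

Definition proj (Q V : 'M[R]_(p, n)) : 'M[R]_(p, n) :=
  xget 0 [set W | is_proj Q V W].

Definition proj_perp (Q V : 'M[R]_(p, n)) : 'M[R]_(p, n) := V - proj Q V.

(* E extends V, normal at Q, to a smooth vector field that is normal along M;
   the field is itself extended to a neighbourhood of M in the ambient space. *)
Definition normal_extension (Q V : 'M[R]_(p, n))
    (E : 'M[R]_(p, n) -> 'M[R]_(p, n)) : Prop :=
  [/\ E Q = V,
      forall Q', manM Q' -> forall U, tangent Q' U -> ip (E Q') U = 0 &
      exists O : set 'M[R]_(p, n), manM `<=` O /\ smooth_on O E].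

(* W is the operator U |-> WW_Q(U, V) = - P_Q (D_U V) on the tangent space. *)
Definition is_weingarten (Q V : 'M[R]_(p, n))
    (W : 'M[R]_(p, n) -> 'M[R]_(p, n)) : Prop :=
  exists E, normal_extension Q V E /\
    forall U, tangent Q U -> W U = - proj Q ('d E Q U).

(* Retraction: a smooth map on the tangent bundle {(Q, U)} with
   Retr_Q 0 = Q and D Retr_Q 0 = id on the tangent space at Q. *)
Record retraction (retr : 'M[R]_(p, n) -> 'M[R]_(p, n) -> 'M[R]_(p, n)) :
    Prop := Retraction {
  retr_man : forall Q U, manM Q -> tangent Q U -> manM (retr Q U);
  retr_zero : forall Q, manM Q -> retr Q 0 = Q;
  retr_deriv : forall Q U, manM Q -> tangent Q U ->
    is_derive (0 : R^o) 1 (fun t : R^o => retr Q (t *: U)) U;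
  retr_smooth : forall Q U, manM Q -> tangent Q U ->
    exists (O : set ('M[R]_(p, n) * 'M[R]_(p, n)))
           (F : 'M[R]_(p, n) * 'M[R]_(p, n) -> 'M[R]_(p, n)),
      [/\ O (Q, U), smooth_on O F &
          forall Q' U', O (Q', U') -> manM Q' -> tangent Q' U' ->
            F (Q', U') = retr Q' U'] }.

Variable s : subproblem R n m.

Definition mapT (X : symmat R n) : symmat R n :=
  (sigma s)^-1 *:
    prox (fun Y => ((sigma s)%:E * conjugate sip (hobj D) Y)%E)
         (sigma s *: X - Zsub s).

(* [fine] loses nothing: by Moreau's decomposition the argument of h is a value
   of prox_{h / sigma}, hence lies in the effective domain of h. *)
Definition Phi (X : symmat R n) : R :=
  fobj D X + fine (hobj D (X - (sigma s)^-1 *: Zsub s - mapT X)) +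
  sigma s / 2 * (frob (opA X - rhsA D - (sigma s)^-1 *: ysub s) ^+ 2 +
                 `|mapT X| ^+ 2).

Definition Psi (Q : 'M[R]_(p, n)) : R := Phi (gram Q).

Definition gradPhi : symmat R n -> symmat R n := grad_of sip Phi.

Definition gradPsi : 'M[R]_(p, n) -> 'M[R]_(p, n) := grad_of ip Psi.

Definition rgradPsi (Q : 'M[R]_(p, n)) : 'M[R]_(p, n) := proj Q (gradPsi Q).

Definition hessPhi (Theta : symmat R n -> symmat R n) (X V : symmat R n) :
    symmat R n :=
  'd gradf X V + sigma s *: adjA (opA V) + sigma s *: Theta V.

Definition ehessPsi (Theta : symmat R n -> symmat R n) (Q U : 'M[R]_(p, n)) :
    'M[R]_(p, n) :=
  2 *: (U *m symval (gradPhi (gram Q))) +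
  2 *: (Q *m symval (hessPhi Theta (gram Q) (dgram Q U))).

(* Elements are operators on the tangent space at Q: their values off the
   tangent space are irrelevant. *)
Definition HessPsi (Q : 'M[R]_(p, n)) :
    set ('M[R]_(p, n) -> 'M[R]_(p, n)) :=
  [set H | exists Theta W,
     [/\ clarke mapT (gram Q) Theta,
         is_weingarten Q (proj_perp Q (gradPsi Q)) W &
         forall U, tangent Q U -> H U = proj Q (ehessPsi Theta Q U) + W U]].

Variable retr : 'M[R]_(p, n) -> 'M[R]_(p, n) -> 'M[R]_(p, n).

Definition derivative_bounds (kPsi kH : R) : Prop :=
  (forall Q, manM Q -> frob (gradPsi Q) <= kPsi) /\
  (forall Q U H, manM Q -> tangent Q U -> HessPsi Q H ->
     frob (H U) <= kH * frob U).

Definition retraction_bounds (alpha beta : R) : Prop :=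
  [/\ 0 < alpha, 0 < beta,
      forall Q U, manM Q -> tangent Q U ->
        frob (retr Q U - Q) <= alpha * frob U &
      forall Q U, manM Q -> tangent Q U ->
        frob (retr Q U - Q - U) <= beta * frob U ^+ 2].

Definition projection_bound (M : R) : Prop :=
  0 < M /\
  forall Q U V, manM Q -> tangent Q U ->
    frob (proj Q V - proj (retr Q U) V) <= M * frob V * frob U.

Definition gradPsi_lipschitz (L : R) : Prop :=
  forall Q W, manM Q -> manM W ->
    frob (gradPsi Q - gradPsi W) <= L * frob (Q - W).

Definition retraction_smoothness (Lbar : R) : Prop :=
  forall Q U, manM Q -> tangent Q U ->
    Psi (retr Q U) <= Psi Q + ip (rgradPsi Q) U + Lbar / 2 * frob U ^+ 2.

Definition Psi_lower_bound (low : R) : Prop :=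
  forall Q, manM Q -> low <= Psi Q.

End Problem.

Record parameters (R : realType) := MkParameters {
  eta1 : R; eta2 : R;
  gamma0 : R; gamma1 : R; gamma2 : R;
  nu_min : R; theta : R; mu : R; nu_init : R }.

Record valid_parameters (R : realType) (a : parameters R) : Prop :=
  ValidParameters {
  eta_valid : [/\ 0 < eta1 a, eta1 a <= eta2 a & eta2 a < 1];
  gamma_valid : [/\ 0 < gamma0 a, gamma0 a < 1, 1 < gamma1 a &
                    gamma1 a <= gamma2 a];
  nu_min_gt0 : 0 < nu_min a;
  theta_ge0 : 0 <= theta a;
  mu_gt0 : 0 < mu a;
  nu_init_gt0 : 0 < nu_init a }.

Section Algorithm.
Context {R : realType} {n p m m0 : nat}.
Variables (D : problem R n m m0) (s : subproblem R n m).
Variable retr : 'M[R]_(p, n) -> 'M[R]_(p, n) -> 'M[R]_(p, n).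
Variable a : parameters R.

Definition model (Q : 'M[R]_(p, n)) (H : 'M[R]_(p, n) -> 'M[R]_(p, n)) (nu : R)
    (U : 'M[R]_(p, n)) : R :=
  ip (rgradPsi D s Q) U + 2^-1 * ip (H U) U + nu / 2 * frob U ^+ 2.

(* g is the gradient at U of F restricted to the tangent space at Q. *)
Definition is_tangent_grad (Q : 'M[R]_(p, n)) (F : 'M[R]_(p, n) -> R)
    (U g : 'M[R]_(p, n)) : Prop :=
  tangent D Q g /\
  forall V, tangent D Q V -> is_derive U V (F : _ -> R^o) (ip g V).

Definition ratio (Q : 'M[R]_(p, n)) (H : 'M[R]_(p, n) -> 'M[R]_(p, n)) (nu : R)
    (U : 'M[R]_(p, n)) : R :=
  (Psi D s (retr Q U) - Psi D s Q) / (model Q H nu U - nu / 2 * frob U ^+ 2).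

Record iteration (Q : 'M[R]_(p, n)) (nu : R)
    (H : 'M[R]_(p, n) -> 'M[R]_(p, n)) (U : 'M[R]_(p, n))
    (Q' : 'M[R]_(p, n)) (nu' : R) : Prop := Iteration {
  iter_hess : HessPsi D s Q H;
  iter_tangent : tangent D Q U;
  iter_inexact : exists g, is_tangent_grad Q (model Q H nu) U g /\
                           frob g <= theta a * frob U;
  iter_model : model Q H nu U <= 0;
  iter_descent : ip U (rgradPsi D s Q) < 0;
  iter_armijo : model Q H nu U <= mu a * ip (rgradPsi D s Q) U;
  iter_accept : eta1 a <= ratio Q H nu U -> Q' = retr Q U;
  iter_reject : ratio Q H nu U < eta1 a -> Q' = Q;
  iter_nu_very_successful : eta2 a <= ratio Q H nu U ->
    Num.max (nu_min a) (gamma0 a * nu) <= nu' <= nu;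
  iter_nu_successful : eta1 a <= ratio Q H nu U < eta2 a ->
    nu <= nu' <= gamma1 a * nu;
  iter_nu_unsuccessful : ratio Q H nu U < eta1 a ->
    gamma1 a * nu <= nu' <= gamma2 a * nu }.

(* A step with <U, grad Psi> < 0 does not exist at a critical point: the run
   stops there, and the entries beyond the first critical iterate are
   meaningless. *)
Definition algorithm_run (Q0 : 'M[R]_(p, n)) (Qs : nat -> 'M[R]_(p, n))
    (nus : nat -> R) (Hs : nat -> 'M[R]_(p, n) -> 'M[R]_(p, n))
    (Us : nat -> 'M[R]_(p, n)) : Prop :=
  [/\ Qs 0%N = Q0, nus 0%N = nu_init a &
      forall l, (forall j, (j <= l)%N -> rgradPsi D s (Qs j) <> 0) ->
        iteration (Qs l) (nus l) (Hs l) (Us l) (Qs l.+1) (nus l.+1)].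

(* Bounds every nu_l as soon as nu_init <= nu_max; and nu_min <= nu_init makes
   the interval for a very successful update nonempty at every iteration. *)
Definition nu_max (Lbar kH : R) : R := gamma2 a * (Lbar + kH) / (1 - eta2 a).

End Algorithm.

(* Main.v *)
Require Import Defs.
From HB Require Import structures.
From mathcomp Require Import all_boot all_order all_algebra.
From mathcomp Require Import all_classical all_reals all_analysis.
From mathcomp Require Import ring lra.

(* A step U at R satisfies |grad Psi(R)| <= (theta + nu + kH) |U|, because the
   gradient of the model differs from grad Psi(R) + nu U by the symmetric part
   of the Hessian element applied to U.  After a successful step the Lipschitz
   and projection bounds give |grad Psi(R')| <= N |U|, while Psi drops by at
   least eta1 nu |U|^2 / 2; hence before the first point with gradient at most
   eps there are at most C = 2 (Psi(R0) - Psi_low) N^2 / (eta1 nu_min eps^2)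
   successful steps.  Since rho >= eta2 as soon as
   nu >= (Lbar + kH) / (1 - eta2), nu stays below nu_max, and comparing
   gamma0^S gamma1^F nu_0 <= nu_max bounds the number F of failures. *)

Set Implicit Arguments.
Unset Strict Implicit.
Unset Printing Implicit Defensive.

Import Order.TTheory GRing.Theory Num.Theory.
Import numFieldNormedType.Exports.

Local Open Scope classical_set_scope.
Local Open Scope ring_scope.

(* Both names are shadowed by the libraries imported after Defs. *)
Local Notation proj := Defs.proj.
Local Notation ratio := Defs.ratio.

(** * Frobenius geometry and projection onto the complement of a finite list *)

Section FrobeniusFacts.
Context {R : realType} {p n : nat}.
Implicit Types A B C : 'M[R]_(p, n).

Lemma ipBl A B C : ip (A - B) C = ip A C - ip B C.
Proof. by rewrite ipDl -scaleN1r ipZl mulN1r. Qed.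

Lemma ip0l A : ip 0 A = 0.
Proof. by rewrite -(scale0r A) ipZl mul0r. Qed.

Lemma frob0 : frob (0 : 'M[R]_(p, n)) = 0.
Proof. by rewrite /frob ip0l sqrtr0. Qed.

Lemma frobN A : frob (- A) = frob A.
Proof. by rewrite -scaleN1r frobZ normrN1 mul1r. Qed.

Lemma frob_gt0 A : A <> 0 -> 0 < frob A.
Proof.
by move=> A0; rewrite lt_neqAle frob_ge0 andbT eq_sym; apply/eqP => /frob_eq0.
Qed.

Lemma normr_ip_le_frob A B : `|ip A B| <= frob A * frob B.
Proof.
rewrite ler_norml ip_le_frob andbT lerNl -mulN1r -ipZl scaleN1r.
by rewrite -(frobN A) ip_le_frob.
Qed.

(** Gram-Schmidt by induction on [s]: [C'] and [W] are the projections of [C] and [A] for the tail,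
    and removing from [W] its component along [C'] enforces the new constraint. If [C'] vanishes,
    the tail already enforces it. *)
Lemma exists_projection (s : seq 'M[R]_(p, n)) A :
  exists W, (forall C, C \in s -> ip C W = 0) /\
    forall U, (forall C, C \in s -> ip C U = 0) -> ip (A - W) U = 0.
Proof.
elim: s A => [|C s IH] A.
  by exists A; split=> // U _; rewrite subrr ip0l.
have [C' [C's C'P]] := IH C; have [W [Ws WP]] := IH A.
have ipC' U : (forall B, B \in s -> ip B U = 0) -> ip C U = ip C' U.
  by move=> /C'P/eqP; rewrite ipBl subr_eq0 => /eqP.
have [C'0|C'0] := eqVneq (ip C' C') 0.
  exists W; split.
    move=> B; rewrite inE => /predU1P[->|/Ws//].
    by rewrite ipC'// (ip_eq0 C'0) ip0l.
  by move=> U Us; apply: WP => B Bs; apply: Us; rewrite inE Bs orbT.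
exists (W - (ip C' W / ip C' C') *: C'); split.
  move=> B; rewrite inE => /predU1P[->|Bs].
    rewrite ipC ipBl ipZl !(ipC _ C) !ipC'//.
    by rewrite divfK// subrr.
  by rewrite ipC ipBl ipZl !(ipC _ B) (Ws B)// (C's B)// mulr0 subr0.
move=> U Us.
have Us' B : B \in s -> ip B U = 0.
  by move=> Bs; apply: Us; rewrite inE Bs orbT.
rewrite opprB addrCA ipDl ipZl -(ipC' U)// Us ?inE ?eqxx// mulr0 add0r.
exact: WP.
Qed.

End FrobeniusFacts.

(** * Linearity of Clarke differentials *)

Section Clarke.
Context {R : realType} (E E' : normedModType R).

(** A limiting Jacobian is a pointwise limit of linear maps, hence linear by uniqueness of limits;
    convex combinations preserve this. *)
Lemma clarke_linear (F : E -> E') (x : E) (J : E -> E') : clarke F x J ->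
  forall a u v, J (a *: u + v) = a *: J u + J v.
Proof.
move=> [k [w [Js [_ _ Jsx JE]]]] a u v.
rewrite !JE scaler_sumr -big_split; apply: eq_bigr => i _ /=.
have [xs [_ _ dxs]] := Jsx i.
suff -> : Js i (a *: u + v) = a *: Js i u + Js i v.
  by rewrite scalerDr !scalerA mulrC.
apply: (norm_cvg_unique (dxs _)).
have -> : (fun k => 'd F (xs k) (a *: u + v)) =
    (fun k => a *: 'd F (xs k) u + 'd F (xs k) v).
  by apply/funext => j; exact: linearP.
by apply: cvgD; [exact: cvgZr|].
Qed.

End Clarke.

(** * Tangent spaces and their orthogonal projections *)

Section Tangent.
Context {R : realType} {n m m0 p : nat} (D : problem R n m m0).
Implicit Types (Q U V : 'M[R]_(p, n)).

(** By symmetry of [matB D i], its trace pairing with [dgram Q U] is twice an inner product. The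
    tangent space thus becomes the complement of a finite list, as in [exists_projection]. *)
Lemma tangentP Q U :
  tangent D Q U <-> forall i, ip (Q *m symval (matB D i)) U = 0.
Proof.
have E i : opB D (dgram Q U) i 0 = 2 * ip (Q *m symval (matB D i)) U.
  have -> : opB D (dgram Q U) i 0 =
      \tr (symval (matB D i) *m (Q^T *m U + U^T *m Q)) by rewrite mxE.
  have -> : ip (Q *m symval (matB D i)) U =
      \tr (symval (matB D i) *m (Q^T *m U)).
    by rewrite /ip trmx_mul (eqP (symvalP _)) mulmxA.
  rewrite mulmxDr mxtraceD mulr_natl mulr2n; congr (_ + _).
  by rewrite -mxtrace_tr !trmx_mul !trmxK (eqP (symvalP _)) mxtrace_mulC.
split=> [T i|T].
  have := E i; rewrite T mxE => /esym/eqP; rewrite mulf_eq0 pnatr_eq0 /=.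
  by move/eqP.
by apply/colP => i; rewrite E T mulr0 mxE.
Qed.

Lemma tangent_linear Q a U V :
  tangent D Q U -> tangent D Q V -> tangent D Q (a *: U + V).
Proof.
move=> /tangentP TU /tangentP TV; apply/tangentP => i.
by rewrite ipC ipDl ipZl ipC TU ipC TV mulr0 addr0.
Qed.

Lemma tangent0 Q : tangent D Q 0.
Proof. by apply/tangentP => i; rewrite ipC ip0l. Qed.

Lemma tangentZ Q a U : tangent D Q U -> tangent D Q (a *: U).
Proof.
by move=> TU; rewrite -[_ *: _]addr0; apply: tangent_linear => //; exact: tangent0.
Qed.

Lemma tangentB Q U V :
  tangent D Q U -> tangent D Q V -> tangent D Q (U - V).
Proof. by rewrite -scaleN1r addrC => TU TV; exact: tangent_linear. Qed.

(** [proj] is a choice with default value 0; the existence of a projection makes the choice a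
    genuine one. *)
Lemma projP Q V : is_proj D Q V (proj D Q V).
Proof.
have [W [WB WP]] := exists_projection
  [seq Q *m symval (matB D i) | i : 'I_m0] V.
suff : is_proj D Q V W by exact: xgetI.
split; first by apply/tangentP => i; apply: WB; exact: fintype.image_f.
by move=> U /tangentP TU; apply: WP => _ /fintype.imageP[i _ ->].
Qed.

Lemma tangent_proj Q V : tangent D Q (proj D Q V).
Proof. by have [] := projP Q V. Qed.

(** The difference of two candidates is tangent and, being a difference of residuals, also normal;
    so it is orthogonal to itself. *)
Lemma proj_unique Q V W : is_proj D Q V W -> W = proj D Q V.
Proof.
move=> [TW WP]; have [TP PP] := projP Q V.
apply/eqP; rewrite -subr_eq0; apply/eqP/ip_eq0.
have -> : W - proj D Q V = (V - proj D Q V) - (V - W).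
  by rewrite opprB [RHS]addrC addrA subrK.
have T : tangent D Q (V - proj D Q V - (V - W)).
  by rewrite opprB addrC addrA subrK; exact: tangentB.
by rewrite ipBl PP// WP// subrr.
Qed.

Lemma proj_linear Q a U V :
  proj D Q (a *: U + V) = a *: proj D Q U + proj D Q V.
Proof.
have [TU PU] := projP Q U; have [TV PV] := projP Q V.
apply/esym/proj_unique; split; first exact: tangent_linear.
move=> W TW; rewrite opprD addrACA -scalerBr ipDl ipZl PU// PV//.
by rewrite mulr0 addr0.
Qed.

Lemma projB Q U V : proj D Q (U - V) = proj D Q U - proj D Q V.
Proof. by rewrite addrC -scaleN1r proj_linear scaleN1r addrC. Qed.

Lemma frob_proj_le Q V : frob (proj D Q V) <= frob V.
Proof.
have [TP PP] := projP Q V.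
have /eqP := PP _ TP; rewrite ipBl subr_eq0 => /eqP E.
have [P0|] := eqVneq (frob (proj D Q V)) 0; first by rewrite P0 frob_ge0.
move=> P0; have Pgt : 0 < frob (proj D Q V) by rewrite lt_neqAle eq_sym P0 frob_ge0.
by rewrite -(ler_pM2r Pgt) -expr2 frob_sqr -E ip_le_frob.
Qed.

Lemma dgram_linear Q a U V :
  dgram Q (a *: U + V) = a *: dgram Q U + dgram Q V.
Proof.
apply: val_inj; rewrite /= mulmxDr -scalemxAr linearD linearZ /=.
by rewrite mulmxDl -scalemxAl scalerDr addrACA.
Qed.

Lemma adjA_opA_linear a (X Y : symmat R n) :
  adjA D (opA D (a *: X + Y)) = a *: adjA D (opA D X) + adjA D (opA D Y).
Proof.
rewrite /adjA scaler_sumr -big_split; apply: eq_bigr => i _ /=.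
by rewrite !mxE /= mulmxDr -scalemxAr linearD linearZ /= scalerDl scalerA.
Qed.

End Tangent.

(** * Linearity of generalized Hessian elements *)

Section Hessian.
Context {R : realType} {n m m0 p : nat} (D : problem R n m m0).
Variable s : subproblem R n m.
Implicit Types (Q U V : 'M[R]_(p, n)).

Lemma ehessPsi_linear Theta Q a U V :
  clarke (mapT D s) (gram Q) Theta ->
  ehessPsi D s Theta Q (a *: U + V) =
    a *: ehessPsi D s Theta Q U + ehessPsi D s Theta Q V.
Proof.
move=> /clarke_linear Tl.
have hl : hessPhi D s Theta (gram Q) (dgram Q (a *: U + V)) =
    a *: hessPhi D s Theta (gram Q) (dgram Q U) +
    hessPhi D s Theta (gram Q) (dgram Q V).
  rewrite /hessPhi dgram_linear adjA_opA_linear Tl linearP /= !scalerDr.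
  rewrite !scalerA !(mulrC (sigma s)) -!scalerA.
  by rewrite [X in X + _ = _]addrACA [LHS]addrACA.
rewrite /ehessPsi hl /= mulmxDl mulmxDr -scalemxAl -scalemxAr !scalerDr.
by rewrite !(scalerA _ a) !(mulrC _ a) -!scalerA addrACA.
Qed.

(** Lets the model be expanded along a tangent line. Only tangent arguments are covered, since [H]
    is arbitrary elsewhere. *)
Lemma HessPsi_linear Q H a U V : HessPsi D s Q H ->
  tangent D Q U -> tangent D Q V -> H (a *: U + V) = a *: H U + H V.
Proof.
move=> [T [W [TT [E [_ WE]] HE]]] TU TV.
have TUV := tangent_linear a TU TV.
rewrite !HE// !WE// ehessPsi_linear//.
have -> : 'd E Q (a *: U + V) = a *: 'd E Q U + 'd E Q V by exact: linearP.
rewrite (proj_linear D Q a ('d E Q U)) (proj_linear D Q a (ehessPsi D s T Q U)).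
by rewrite opprD scalerDr scalerN addrACA.
Qed.

End Hessian.

(** For [t != 0] the difference quotient is exactly [c + t * d]. Serves for the model, which is
    quadratic along tangent lines. *)
Lemma derive_quadratic (R : realType) (E : normedModType R) (f : E -> R^o)
    (x v : E) (c d : R) :
  (forall t, f (t *: v + x) = f x + t * c + t ^+ 2 * d) -> 'D_v f x = c.
Proof.
move=> fE; apply: cvg_lim; first exact: norm_hausdorff.
have cd : (fun t : R => c + t * d : R^o) @ 0^' --> (c : R^o).
  rewrite -[X in _ --> X]addr0 -[X in _ --> _ + X](mul0r d).
  apply: cvgD; first exact: cvg_cst.
  apply: cvgM; last exact: cvg_cst.
  by apply: cvg_trans (cvg_id); apply: nbhs_dnbhs.
apply: cvg_trans cd; apply: near_eq_cvg; near=> t.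
have t0 : t != 0 by near: t; exact: nbhs_dnbhs_neq.
rewrite /= fE [X in _ *: X]addrC !addrA addNr add0r /GRing.scale /=.
by rewrite mulrDr mulKf// expr2 -mulrA mulKf.
Unshelve. all: by end_near.
Qed.

(** * Estimates for a single iteration *)

Section Iteration.
Context {R : realType} {n m m0 p : nat} (D : problem R n m m0).
Variables (s : subproblem R n m).
Variable retr : 'M[R]_(p, n) -> 'M[R]_(p, n) -> 'M[R]_(p, n).
Implicit Types (Q U V : 'M[R]_(p, n)).

(* Elements of the generalized Hessian are not known to be self-adjoint; the
   symmetric part of H is bounded by kH as well. *)
Lemma frob_rgradPsi_le_model kPsi kH Q H nu U g :
  derivative_bounds D s (p := p) kPsi kH -> manM D Q -> HessPsi D s Q H ->
  tangent D Q U -> 0 <= nu -> is_tangent_grad D Q (model D s Q H nu) U g ->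
  frob (rgradPsi D s Q) <= frob g + (kH + nu) * frob U.
Proof.
move=> [_ HK] MQ HH TU nu0 [Tg gP].
have hK V : tangent D Q V -> frob (H V) <= kH * frob V by move=> TV; exact: HK MQ TV HH.
pose w := g - rgradPsi D s Q - nu *: U.
have Tw : tangent D Q w.
  apply: tangentB; last exact: tangentZ.
  by apply: tangentB => //; exact: tangent_proj.
have ipw V : tangent D Q V -> ip w V = 2^-1 * (ip (H V) U + ip (H U) V).
  move=> TV; have := @derive_val _ _ _ _ _ _ _ (gP V TV).
  rewrite (@derive_quadratic _ _ _ _ _ (ip (rgradPsi D s Q) V +
    2^-1 * (ip (H V) U + ip (H U) V) + nu * ip U V)
    (2^-1 * ip (H V) V + nu / 2 * ip V V)).
    by rewrite /w !ipBl ipZl => <-; rewrite addrAC addrK addrAC subrr add0r.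
  move=> t; rewrite /model (HessPsi_linear t HH TV TU) !frob_sqr !(ipDl, ipDr, ipZl, ipZr).
  by rewrite (ipC V U); field.
(* [w] is the symmetric part of [H] applied to [U]; testing [ipw] with [V = w] and applying
   Cauchy-Schwarz to both terms bounds it. *)
have w_le : frob w <= kH * frob U.
  have [w0|w0] := eqVneq (frob w) 0.
    by rewrite w0; apply: le_trans (hK U TU); exact: frob_ge0.
  have wgt : 0 < frob w by rewrite lt_neqAle eq_sym w0 frob_ge0.
  rewrite -(ler_pM2r wgt) -expr2 frob_sqr ipw//.
  have h1 := ip_le_frob (H w) U; have h2 := ip_le_frob (H U) w.
  have h3 := ler_wpM2r (frob_ge0 U) (hK _ Tw).
  have h4 := ler_wpM2r (frob_ge0 w) (hK _ TU).
  lra.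
have -> : rgradPsi D s Q = g + - (w + nu *: U).
  by rewrite /w subrK opprB addrC subrK.
apply: le_trans (frobD _ _) _; rewrite frobN lerD2l mulrDl.
by apply: le_trans (frobD _ _) _; rewrite frobZ ger0_norm// lerD2r.
Qed.

(* This absorbs the factor alpha that N carries on kPsi * M but the projection
   bound does not provide.  Scaling the step by a small t makes the quadratic
   error of the retraction negligible against the linear term. *)
Lemma retraction_const_ge1 alpha beta Q U :
  retraction_bounds D retr alpha beta -> manM D Q -> tangent D Q U -> U <> 0 ->
  1 <= alpha.
Proof.
move=> [a0 b0 ra rb] MQ TU /frob_gt0 u0; rewrite leNgt; apply/negP => a1.
(* With this [t] the two retraction bounds give [t * frob U <= (1 + alpha) / 2 * (t * frob U)],
   impossible for [alpha < 1]. *)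
pose t : R := (1 - alpha) / (2 * beta * frob U).
have t0 : 0 < t by rewrite divr_gt0 ?subr_gt0// !mulr_gt0.
have tu : beta * (t * frob U) = (1 - alpha) / 2.
  by rewrite /t; field; rewrite !gt_eqF.
have TtU := tangentZ t TU.
have h1 := ra _ _ MQ TtU; have h2 := rb _ _ MQ TtU.
have := frobD (retr Q (t *: U) - Q) (- (retr Q (t *: U) - Q - t *: U)).
rewrite subKr frobN; move: h1 h2; rewrite frobZ gtr0_norm//.
move=> h1 h2 h3.
have : t * frob U <= (alpha + beta * (t * frob U)) * (t * frob U).
  by rewrite mulrDl -mulrA -expr2; lra.
rewrite -[leLHS]mul1r tu (ler_pM2r (mulr_gt0 t0 u0)) => ?; lra.
Qed.

(** For a short enough step the retraction error is at most half the step, so the retraction really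
    moves [Q]; the Lipschitz bound between two distinct points forces the sign of [L]. *)
Lemma gradPsi_lipschitz_ge0 alpha beta L Q U :
  retraction D retr -> retraction_bounds D retr alpha beta ->
  gradPsi_lipschitz D s (p := p) L ->
  manM D Q -> tangent D Q U -> U <> 0 -> 0 <= L.
Proof.
move=> [rM _ _ _] [a0 b0 ra rb] Lip MQ TU /frob_gt0 u0.
pose t : R := (2 * beta * frob U)^-1.
have t0 : 0 < t by rewrite invr_gt0 !mulr_gt0.
have tu : beta * (t * frob U) = 2^-1 by rewrite /t; field; rewrite !gt_eqF.
have TtU := tangentZ t TU.
have h2 := rb _ _ MQ TtU.
have := frobD (retr Q (t *: U) - Q) (- (retr Q (t *: U) - Q - t *: U)).
rewrite subKr frobN; move: h2; rewrite frobZ gtr0_norm// => h2 h3.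
have tu0 : 0 < t * frob U by rewrite mulr_gt0.
have h4 : beta * (t * frob U) ^+ 2 = 2^-1 * (t * frob U).
  by rewrite expr2 mulrA tu.
have rQ : 0 < frob (retr Q (t *: U) - Q) by lra.
rewrite -(pmulr_lge0 _ rQ); apply: le_trans (Lip _ _ (rM _ _ MQ TtU) MQ).
exact: frob_ge0.
Qed.

(** With [W = retr Q U], the new gradient is the old one, plus the projection at [W] of the change
    in [gradPsi], minus the change of projector applied to [gradPsi D s Q]. The last two are
    controlled by [L] and [M]; [1 <= alpha] then inserts the factor [alpha] next to [kPsi * M]. *)
Lemma frob_rgradPsi_retr_le kPsi kH alpha beta M L Q U :
  retraction D retr -> derivative_bounds D s (p := p) kPsi kH ->
  retraction_bounds D retr alpha beta -> projection_bound D retr M ->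
  gradPsi_lipschitz D s (p := p) L ->
  manM D Q -> tangent D Q U -> U <> 0 ->
  frob (rgradPsi D s (retr Q U)) <=
    frob (rgradPsi D s Q) + (alpha * L + alpha * kPsi * M) * frob U.
Proof.
move=> rt [gK _] rb [M0 pM] Lip MQ TU U0.
have a1 := retraction_const_ge1 rb MQ TU U0.
have L0 := gradPsi_lipschitz_ge0 rt rb Lip MQ TU U0.
have [_ _ ra _] := rb; have MW := retr_man rt MQ TU.
have k0 : 0 <= kPsi by apply: le_trans (gK _ MQ); exact: frob_ge0.
set W := retr Q U.
have -> : rgradPsi D s W = proj D W (gradPsi D s W - gradPsi D s Q) +
    (rgradPsi D s Q + - (proj D Q (gradPsi D s Q) - proj D W (gradPsi D s Q))).
  have E (X Y Z : 'M[R]_(p, n)) : X = X - Y + (Z - (Z - Y)).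
    by rewrite subKr subrK.
  by rewrite projB; exact: E.
apply: le_trans (frobD _ _) _; rewrite mulrDl addrCA lerD//.
  apply: le_trans (frob_proj_le _ _ _) _; apply: le_trans (Lip _ _ MW MQ) _.
  by rewrite (mulrC alpha) -mulrA ler_wpM2l// ra.
apply: le_trans (frobD _ _) _; rewrite frobN lerD2l.
apply: le_trans (pM _ _ _ MQ TU) _; rewrite ler_wpM2r ?frob_ge0//.
rewrite (mulrC M) (ler_wpM2r (ltW M0))//.
apply: le_trans (gK _ MQ) _; exact: ler_peMl.
Qed.

Variable a : parameters R.

Lemma iteration_step_neq0 Q nu H U Q' nu' :
  iteration D s retr a Q nu H U Q' nu' -> U <> 0.
Proof. by move=> it U0; have := iter_descent it; rewrite U0 ip0l ltxx. Qed.

Lemma iteration_denom_le Q nu H U Q' nu' :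
  iteration D s retr a Q nu H U Q' nu' ->
  model D s Q H nu U - nu / 2 * frob U ^+ 2 <= - (nu / 2 * frob U ^+ 2).
Proof. by move=> it; rewrite lerBlDr addNr (iter_model it). Qed.

(** Clearing this denominator in a lower bound on [ratio] reverses the inequality. *)
Lemma iteration_denom_lt0 Q nu H U Q' nu' :
  iteration D s retr a Q nu H U Q' nu' -> 0 < nu ->
  model D s Q H nu U - nu / 2 * frob U ^+ 2 < 0.
Proof.
move=> it nu0; apply: le_lt_trans (iteration_denom_le it) _.
rewrite oppr_lt0 mulr_gt0 ?divr_gt0 ?exprn_gt0//.
exact/frob_gt0/(iteration_step_neq0 it).
Qed.

(** With [d] the denominator and [u = frob U ^+ 2], the change in [Psi] is at most
    [d + (Lbar + kH) / 2 * u], hence at most [d + (1 - eta2 a) * nu / 2 * u]. As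
    [nu / 2 * u <= - d], this is at most [eta2 a * d]. *)
Lemma ratio_ge_eta2 kPsi kH Lbar Q nu H U Q' nu' :
  derivative_bounds D s (p := p) kPsi kH -> retraction_smoothness D s retr Lbar ->
  iteration D s retr a Q nu H U Q' nu' -> manM D Q -> 0 < nu ->
  eta2 a < 1 -> (Lbar + kH) / (1 - eta2 a) <= nu ->
  eta2 a <= ratio D s retr Q H nu U.
Proof.
move=> [_ HK] Lb it MQ nu0 e1; rewrite ler_pdivrMr ?subr_gt0// => hnu.
have TU := iter_tangent it.
rewrite /ratio ler_ndivlMr; last exact: iteration_denom_lt0 it nu0.
have := iteration_denom_le it; rewrite {1 2}/model addrK.
set d := (X in X <= _ -> _) => dle.
have {}Lb := Lb _ _ MQ TU.
have hH : - (kH * frob U ^+ 2) <= ip (H U) U.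
  have := normr_ip_le_frob (H U) U; rewrite ler_norml => /andP[+ _].
  apply: le_trans; rewrite lerN2 expr2 mulrA ler_wpM2r ?frob_ge0//.
  exact: HK MQ TU (iter_hess it).
have e0 : 0 < 1 - eta2 a by rewrite subr_gt0.
have h1 := ler_wpM2r (sqr_ge0 (frob U)) hnu.
have h2 := ler_wpM2l (ltW e0) dle.
have dE : d = ip (rgradPsi D s Q) U + 2^-1 * ip (H U) U by [].
clearbody d; move: Lb hH h1 h2 dE.
move: (Psi D s (retr Q U)) (Psi D s Q) (ip (rgradPsi D s Q) U) (ip (H U) U).
move: (frob U ^+ 2) => u P' P r h Lb hH h1 h2 dE.
rewrite -dE; lra.
Qed.

(** Since the model value is nonpositive, removing the regularization term from it leaves at most
    [- (nu / 2 * frob U ^+ 2)]. *)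
Lemma iteration_decrease Q nu H U Q' nu' :
  iteration D s retr a Q nu H U Q' nu' -> 0 < nu -> 0 <= eta1 a ->
  eta1 a <= ratio D s retr Q H nu U ->
  eta1 a * nu / 2 * frob U ^+ 2 <= Psi D s Q - Psi D s Q'.
Proof.
move=> it nu0 e0 rho; rewrite (iter_accept it rho).
move: rho; rewrite /ratio ler_ndivlMr; last exact: iteration_denom_lt0 it nu0.
have := ler_wpM2l e0 (iteration_denom_le it).
move: (Psi D s (retr Q U)) (Psi D s Q) (model D s Q H nu U) (frob U ^+ 2).
by move=> P' P d u h1 h2; lra.
Qed.

Lemma iteration_manM Q nu H U Q' nu' : retraction D retr ->
  iteration D s retr a Q nu H U Q' nu' -> manM D Q -> manM D Q'.
Proof.
move=> rt it MQ; have [rho|rho] := leP (eta1 a) (ratio D s retr Q H nu U).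
  by rewrite (iter_accept it rho); exact: (retr_man rt MQ (iter_tangent it)).
by rewrite (iter_reject it rho).
Qed.

Lemma iteration_nu_min Q nu H U Q' nu' : valid_parameters a ->
  iteration D s retr a Q nu H U Q' nu' -> nu_min a <= nu -> nu_min a <= nu'.
Proof.
move=> [_ [_ _ g1 _] nm0 _ _ _] it nmin.
have nu0 : 0 < nu := lt_le_trans nm0 nmin.
have [r2|r2] := leP (eta2 a) (ratio D s retr Q H nu U).
  by have := iter_nu_very_successful it r2; rewrite ge_max => /andP[/andP[]].
have [r1|r1] := leP (eta1 a) (ratio D s retr Q H nu U).
  have /andP[+ _] : nu <= nu' <= gamma1 a * nu.
    by apply: (iter_nu_successful it); rewrite r1.
  exact: le_trans.
have /andP[+ _] := iter_nu_unsuccessful it r1; apply: le_trans.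
by apply: le_trans nmin _; rewrite ler_peMl// ltW.
Qed.

(** The parameter can grow only when [ratio] is below [eta2 a], so only from below the threshold of
    [ratio_ge_eta2], and by a factor at most [gamma2 a]. *)
Lemma iteration_nu_max kPsi kH Lbar Q nu H U Q' nu' : valid_parameters a ->
  derivative_bounds D s (p := p) kPsi kH -> retraction_smoothness D s retr Lbar ->
  iteration D s retr a Q nu H U Q' nu' -> manM D Q -> 0 < nu ->
  nu <= nu_max a Lbar kH -> nu' <= nu_max a Lbar kH.
Proof.
move=> [[_ e12 e2] [_ _ g1 g2] _ _ _ _] DB Lb it MQ nu0 nmax.
have g20 : 0 < gamma2 a by lra.
have [r2|r2] := leP (eta2 a) (ratio D s retr Q H nu U).
  have /andP[_ h] := iter_nu_very_successful it r2.
  exact: le_trans h nmax.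
have nu'_le : nu' <= gamma2 a * nu.
  have [r1|r1] := leP (eta1 a) (ratio D s retr Q H nu U).
    have /andP[_ h] : nu <= nu' <= gamma1 a * nu.
      by apply: (iter_nu_successful it); rewrite r1.
    by apply: le_trans h _; rewrite ler_pM2r.
  by have /andP[] := iter_nu_unsuccessful it r1.
apply: le_trans nu'_le _; rewrite /nu_max -mulrA ler_pM2l// leNgt.
apply/negP => /ltW /(ratio_ge_eta2 DB Lb it MQ nu0 e2).
by rewrite leNgt r2.
Qed.

End Iteration.

(** * Counting successful and unsuccessful iterations *)

(* [S] is the number of successful indices below [K]. *)
Lemma success_count (R : realType) (g0 g1 delta : R) (psi nu : nat -> R)
    (succ : nat -> bool) (K : nat) :
  0 < g0 -> 0 < g1 ->
  (forall l, (l < K)%N -> if succ l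
    then delta <= psi l - psi l.+1 /\ g0 * nu l <= nu l.+1
    else psi l.+1 = psi l /\ g1 * nu l <= nu l.+1) ->
  exists S, [/\ (S <= K)%N, S%:R * delta <= psi 0%N - psi K &
    g0 ^+ S * g1 ^+ (K - S) * nu 0%N <= nu K].
Proof.
move=> g00 g10; elim: K => [|K IH] step.
  by exists 0%N; rewrite subrr mul0r !expr0 !mul1r.
have [S [SK Sd Sn]] := IH (fun l lK => step l (ltnW lK)).
have := step K (ltnSn K); case: (succ K) => -[dK nK].
  exists S.+1; split=> //; first by rewrite -natr1 mulrDl mul1r; lra.
  rewrite subSS; apply: le_trans nK.
  by rewrite exprS -!mulrA ler_pM2l// mulrA.
exists S; split; [exact: leqW|by rewrite dK|].
rewrite subSn//; apply: le_trans nK.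
by rewrite exprS mulrCA -mulrA ler_pM2l// mulrA.
Qed.

(** Take logarithms, use [ln g0 < 0], and divide by [ln g1 > 0]. Here [F] counts failures and [S]
    successes. *)
Lemma ln_count_bound (R : realType) (g0 g1 x y : R) (S F : nat) :
  0 < g0 -> g0 < 1 -> 1 < g1 -> 0 < x -> g0 ^+ S * g1 ^+ F * x <= y ->
  F%:R <= S%:R * (`|ln g0| / ln g1) + 1 / ln g1 * ln (y / x).
Proof.
move=> g00 g01 g11 x0 h.
have g10 : 0 < g1 by lra.
have l1 : 0 < ln g1 by rewrite ln_gt0.
have y0 : 0 < y by apply: lt_le_trans h; rewrite !mulr_gt0 ?exprn_gt0.
have : ln (g0 ^+ S * g1 ^+ F) <= ln (y / x).
  rewrite ler_ln ?posrE; first by rewrite ler_pdivlMr.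
    by rewrite mulr_gt0 ?exprn_gt0.
  by rewrite divr_gt0.
rewrite lnM ?posrE ?exprn_gt0// !lnXn// ler0_norm; last exact/ln_le0/ltW.
rewrite -(mulr_natl (ln g0)) -(mulr_natl (ln g1)) => hw.
have divE (u v w : R) : 0 < v ->
    (S%:R * (- u / v) + 1 / v * w) * v = w - S%:R * u.
  by move=> v0; field; rewrite gt_eqF.
by rewrite -(ler_pM2r l1) divE// lerBrDl.
Qed.

(** * Complexity of a whole run *)

Lemma iteration_grad_le (R : realType) (n m m0 p : nat) (D : problem R n m m0)
    (s : subproblem R n m) (retr : 'M[R]_(p, n) -> 'M[R]_(p, n) -> 'M[R]_(p, n))
    (a : parameters R) kPsi kH Q nu H U Q' nu' :
  derivative_bounds D s (p := p) kPsi kH ->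
  iteration D s retr a Q nu H U Q' nu' -> manM D Q -> 0 <= nu ->
  frob (rgradPsi D s Q) <= (theta a + nu + kH) * frob U.
Proof.
move=> DB it MQ nu0; have [g [gP gU]] := iter_inexact it.
apply: le_trans (frob_rgradPsi_le_model DB MQ (iter_hess it) (iter_tangent it)
  nu0 gP) _.
by rewrite -[theta a + _ + _]addrA (addrC nu) [leRHS]mulrDl lerD2r.
Qed.

Theorem corollary3p8 (R : realType) (n p m m0 : nat)
  (D : problem R n m m0) (s : subproblem R n m)
  (retr : 'M[R]_(p, n) -> 'M[R]_(p, n) -> 'M[R]_(p, n))
  (kPsi kH alpha beta M LPsi Lbar Psi_low : R) (a : parameters R)
  (R0 : 'M[R]_(p, n)) (Rs : nat -> 'M[R]_(p, n)) (nus : nat -> R)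
  (Hs : nat -> 'M[R]_(p, n) -> 'M[R]_(p, n)) (Us : nat -> 'M[R]_(p, n))
  (eps : R) :
  (0 < p)%N -> 0 < sigma s ->
  objective_assumptions D ->
  constraint_assumptions D (p := p) ->
  retraction D retr ->
  derivative_bounds D s (p := p) kPsi kH ->
  retraction_bounds D retr alpha beta ->
  projection_bound D retr M ->
  gradPsi_lipschitz D s (p := p) LPsi ->
  retraction_smoothness D s retr Lbar ->
  Psi_lower_bound D s (p := p) Psi_low ->
  valid_parameters a ->
  nu_min a <= nu_init a <= nu_max a Lbar kH ->
  manM D R0 ->
  algorithm_run D s retr a R0 Rs nus Hs Us ->
  0 < eps ->
  let numax := nu_max a Lbar kH in
  let N := theta a + numax + alpha * LPsi + alpha * kPsi * M + kH in
  exists l : nat,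
    [/\ manM D (Rs l),
        frob (rgradPsi D s (Rs l)) <= eps &
        l%:R <= (1 + `|ln (gamma0 a)| / ln (gamma1 a)) *
                  (2 * (Psi D s R0 - Psi_low) / (eta1 a * nu_min a)) *
                  N ^+ 2 * (1 / eps ^+ 2) +
                1 / ln (gamma1 a) * ln (numax / nu_init a) + 1].
Proof.
move=> _ _ _ _ rt DB RB PB Lip Lb low vp /andP[nmin nmax] MR [R0E nu0E run].
move=> eps0 numax N.
have [[e10 e12 e21] [g00 g01 g11 g12] nm0 th0 _ nui0] := vp.
pose C := 2 * (Psi D s R0 - Psi_low) / (eta1 a * nu_min a) * N ^+ 2
  * (1 / eps ^+ 2).
have low0 : 0 <= Psi D s R0 - Psi_low by rewrite subr_ge0; exact: low.
have e1nm : 0 < eta1 a * nu_min a by rewrite mulr_gt0.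
have C0 : 0 <= C.
  apply: mulr_ge0; last by rewrite divr_ge0 ?sqr_ge0.
  apply: mulr_ge0; last exact: sqr_ge0.
  by apply: divr_ge0; [exact: mulr_ge0|exact: ltW].
have l1 : 0 < ln (gamma1 a) by rewrite ln_gt0.
have ratio0 : 0 <= `|ln (gamma0 a)| / ln (gamma1 a).
  by rewrite divr_ge0 ?normr_ge0// ltW.
pose bound := (1 + `|ln (gamma0 a)| / ln (gamma1 a)) * C +
  1 / ln (gamma1 a) * ln (numax / nu_init a) + 1.
have lnmax0 : 0 <= 1 / ln (gamma1 a) * ln (numax / nu_init a).
  by rewrite mulr_ge0 ?divr_ge0 ?(ltW l1)// ln_ge0// ler_pdivlMr// mul1r.
have bound0 : 0 <= bound by rewrite !addr_ge0// mulr_ge0// addr_ge0.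
(* The last index that the claim allows. If it fails, every gradient up to [K] exceeds [eps]. *)
pose K := Num.trunc bound.
have K_le : K%:R <= bound by rewrite /K truncn_le.
apply: contrapT => no.
(* All [j <= l] are carried along because [run] yields iteration [l] only when no earlier gradient,
   nor the one at [l], vanishes. *)
have inv : forall l, (l <= K)%N -> forall j, (j <= l)%N ->
    [/\ manM D (Rs j), nu_min a <= nus j, nus j <= numax &
        eps < frob (rgradPsi D s (Rs j))].
  have far l : (l <= K)%N -> manM D (Rs l) -> eps < frob (rgradPsi D s (Rs l)).
    move=> lK Ml; rewrite ltNge; apply/negP => le; apply: no; exists l.
    split=> //; apply: le_trans (_ : bound <= _); last by rewrite /bound /C !mulrA.
    by apply: le_trans K_le; rewrite ler_nat.
  elim=> [_ j|l IH lK j].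
    rewrite leqn0 => /eqP ->; rewrite nu0E; split=> //; first by rewrite R0E.
    by apply: far => //; rewrite R0E.
  have {}IH := IH (ltnW lK).
  rewrite leq_eqVlt ltnS => /predU1P[->|]; last exact: IH.
  have [Ml nul nul' _] := IH l (leqnn l).
  have it : iteration D s retr a (Rs l) (nus l) (Hs l) (Us l) (Rs l.+1)
      (nus l.+1).
    apply: run => i il g0; have [_ _ _] := IH i il.
    by rewrite g0 frob0 ltNge ltW.
  have nu0 := lt_le_trans nm0 nul.
  have Ml1 := iteration_manM rt it Ml.
  split=> //; [exact: (iteration_nu_min vp it nul)| |exact: far].
  exact: (iteration_nu_max vp DB Lb it Ml nu0 nul').
have it l : (l <= K)%N ->
    iteration D s retr a (Rs l) (nus l) (Hs l) (Us l) (Rs l.+1) (nus l.+1).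
  move=> lK; apply: run => i il g0; have [_ _ _] := inv l lK i il.
  by rewrite g0 frob0 ltNge ltW.
have grad_le l : (l <= K)%N ->
    frob (rgradPsi D s (Rs l)) <= (theta a + numax + kH) * frob (Us l).
  move=> lK; have [Ml nul nul' _] := inv l lK l (leqnn l).
  apply: le_trans (iteration_grad_le DB (it l lK) Ml _) _.
    by rewrite (le_trans (ltW nm0)).
  by rewrite ler_wpM2r ?frob_ge0// lerD2r lerD2l.
have NE : N = theta a + numax + kH + (alpha * LPsi + alpha * kPsi * M).
  by rewrite /N; ring.
(* At index 0 the gradient exceeds [eps], so [grad_le] forces [theta a + numax + kH] to be
   positive. *)
have N0 : 0 < N.
  have [M0 _ _ g0] := inv 0%N (leq0n K) 0%N (leqnn 0).
  have it0 := it 0%N (leq0n K); have U0 := iteration_step_neq0 it0.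
  have L0 := gradPsi_lipschitz_ge0 rt RB Lip M0 (iter_tangent it0) U0.
  have [gK _] := DB; have k0 := le_trans (frob_ge0 _) (gK _ M0).
  have [a0 _ _ _] := RB; have [Mp _] := PB.
  have := lt_le_trans (lt_trans eps0 g0) (grad_le 0%N (leq0n K)).
  rewrite pmulr_lgt0 ?frob_gt0// NE => h; apply: ltr_wpDr h.
  by rewrite addr_ge0 ?mulr_ge0// ltW.
(* Guaranteed decrease of a successful step, from [nu_min a <= nus l] and
   [eps / N <= frob (Us l)]. *)
pose delta := eta1 a * nu_min a / 2 * (eps / N) ^+ 2.
have delta0 : 0 < delta.
  by apply: mulr_gt0; [exact: divr_gt0|rewrite exprn_gt0// divr_gt0].
have [S [SK Sd Snu]] : exists S, [/\ (S <= K)%N,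
    S%:R * delta <= Psi D s (Rs 0%N) - Psi D s (Rs K) &
    gamma0 a ^+ S * gamma1 a ^+ (K - S) * nus 0%N <= nus K].
  apply: (@success_count _ _ _ _ (fun l => Psi D s (Rs l)) _ (fun l =>
    eta1 a <= ratio D s retr (Rs l) (Hs l) (nus l) (Us l))) => //.
    exact: lt_trans ltr01 g11.
  move=> l lK; have itl := it l (ltnW lK).
  have [Ml nul _ _] := inv l (ltnW lK) l (leqnn l).
  (* The step length is bounded below through the gradient at the next point, so only the indices
     below [K] are counted. *)
  have [_ _ _ gl1] := inv l.+1 lK l.+1 (leqnn _).
  have nu0 := lt_le_trans nm0 nul.
  have [rho|rho] := leP (eta1 a) _; last first.
    split; first by rewrite (iter_reject itl rho).
    by have /andP[] := iter_nu_unsuccessful itl rho.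
  split.
    apply: le_trans (iteration_decrease itl nu0 (ltW e10) rho).
    have U0 := iteration_step_neq0 itl.
    have : eps <= N * frob (Us l).
      apply/ltW/(lt_le_trans gl1); rewrite (iter_accept itl rho).
      apply: le_trans (frob_rgradPsi_retr_le rt DB RB PB Lip Ml
        (iter_tangent itl) U0) _.
      rewrite NE (mulrDl (theta a + numax + kH)) lerD2r.
      exact: grad_le (ltnW lK).
    rewrite mulrC -ler_pdivrMr// => epsU.
    rewrite /delta ler_pM// ?sqr_ge0 ?divr_ge0 ?(ltW e1nm)//.
      by rewrite ler_pM2r// ler_pM2l.
    by rewrite ler_pXn2r// nnegrE ?frob_ge0// divr_ge0// ltW.
  have [r2|r2] := leP (eta2 a)
      (ratio D s retr (Rs l) (Hs l) (nus l) (Us l)).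
    by have := iter_nu_very_successful itl r2; rewrite ge_max => /andP[/andP[]].
  have /andP[+ _] : nus l <= nus l.+1 <= gamma1 a * nus l.
    by apply: (iter_nu_successful itl); rewrite rho.
  by apply: le_trans; rewrite ler_piMl// ltW.
have [MK _ nuK _] := inv K (leqnn K) K (leqnn K).
have SC : S%:R <= C.
  rewrite -(ler_pM2r delta0); apply: le_trans Sd _.
  (* [C] is the total available decrease divided by [delta]. *)
  have -> : C * delta = Psi D s R0 - Psi_low.
    rewrite /C /delta; move: (_ - _) => x; field.
    by rewrite !gt_eqF.
  by rewrite R0E lerD2l lerN2; exact: low.
have nui := Snu; rewrite nu0E in nui.
suff : bound < bound by rewrite ltxx.
(* Truncation gives [bound < K + 1]; the final [+ 1] in [bound] absorbs this unit, leaving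
   [K = S + (K - S)] to be bounded. *)
apply: lt_le_trans (truncnS_gt bound) _.
rewrite -/K -natr1 -(subnKC SK) natrD /bound lerD2r mulrDl mul1r -addrA lerD//.
apply: le_trans (ln_count_bound g00 g01 g11 nui0 (le_trans nui nuK)) _.
by rewrite lerD2r (mulrC _ C) ler_wpM2r.
Qed.
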